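(* Let $n \geq 2$ and $d \geq 1$ be integers, let $|||\cdot|||$ be a unitarily invariant norm on $M(d)$, and suppose that $A_1, A_2, \dots, A_n \in M(d)$ are positive-semidefinite. Then $$\frac{1}{n^2} \sum_{j,k=1}^{n} |||A_j A_k||| \;\geq\; \frac{1}{n(n-1)} \sum_{\substack{j,k=1 \\ j \neq k}}^{n} |||A_j A_k|||.$$
   Context: $M(d)$ denotes the space of complex $d \times d$ matrices. A norm $|||\cdot|||$ on $M(d)$ is called unitarily invariant if $|||UX||| = |||XU||| = |||X|||$ for all $X, U \in M(d)$ with $U$ unitary. Positive-semidefinite matrices are Hermitian. *)

(* Defs.v *)
From mathcomp Require Import all_boot all_order all_algebra.
From mathcomp Require Export spectral sesquilinear complex reals.

Set Implicit Arguments.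
Unset Strict Implicit.
Unset Printing Implicit Defensive.

Import Order.TTheory GRing.Theory Num.Theory.
Local Open Scope ring_scope.
Local Open Scope sesquilinear_scope.
Local Open Scope complex_scope.

(* The modulus of a complex scalar is valued in R[i] in the library, so
   homogeneity is stated there, through the embedding %:C of R in R[i]. *)
Record is_norm (R : realType) (d : nat) (N : 'M[R[i]]_d -> R) : Prop := IsNorm {
  norm_ge0 : forall X, 0 <= N X;
  norm_eq0 : forall X, N X = 0 -> X = 0;
  norm_scale : forall (c : R[i]) X, (N (c *: X))%:C = `|c| * (N X)%:C;
  norm_triangle : forall X Y, N (X + Y) <= N X + N Y
}.

Definition unitarily_invariant (R : realType) (d : nat) (N : 'M[R[i]]_d -> R)
    : Prop :=
  forall X U : 'M[R[i]]_d, U \is unitarymx ->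
    N (U *m X) = N X /\ N (X *m U) = N X.

(* In the order of R[i], 0 <= z means that z is real and nonnegative. *)
Definition possemidef (R : realType) (d : nat) (A : 'M[R[i]]_d) : Prop :=
  A \is hermsymmx /\ forall x : 'cV[R[i]]_d, 0 <= (x ^t* *m A *m x) 0 0.

(* Main.v *)
(** Summing |||A_j A_k||| <= (|||A_j^2||| + |||A_k^2|||) / 2 over j <> k gives
    the theorem. If X^* Y has singular value decomposition U diag(s) V^*, then
    (X U)^* (Y V) = diag(s), and positivity of (X U - Y V)^* (X U - Y V) shows
    that s is dominated by the diagonal of the half-sum of (X U)^* (X U) and
    (Y V)^* (Y V). A unitarily invariant norm does not increase under passing
    to the diagonal, nor under decreasing nonnegative diagonal entries, because
    both operations are averages of multiplications by unitary matrices. *)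

Require Import Defs.
From mathcomp Require Import all_boot all_order all_algebra.
From mathcomp Require Import ring lra.

Set Implicit Arguments.
Unset Strict Implicit.
Unset Printing Implicit Defensive.

Import Order.TTheory GRing.Theory Num.Theory.

Local Open Scope complex_scope.
Local Open Scope ring_scope.
Local Open Scope sesquilinear_scope.

(** * Adjoints, Gram matrices and singular values *)

Lemma trmxC_mul (C : numClosedFieldType) (m n p : nat)
    (A : 'M[C]_(m, n)) (B : 'M[C]_(n, p)) :
  (A *m B)^t* = B^t* *m A^t*.
Proof. by rewrite trmx_mul map_mxM. Qed.

Lemma trmxC_sub (C : numClosedFieldType) (m n : nat) (A B : 'M[C]_(m, n)) :
  (A - B)^t* = A^t* - B^t*.
Proof. by rewrite linearB /= map_mxB. Qed.

Lemma gram_diag_ge0 (C : numClosedFieldType) (m n : nat)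
    (Z : 'M[C]_(m, n)) (i : 'I_n) : 0 <= (Z^t* *m Z) i i.
Proof.
by rewrite mxE sumr_ge0// => k _; rewrite !mxE mulrC mul_conjC_ge0.
Qed.

Lemma herm_trmxC (C : numClosedFieldType) (n : nat) (A : 'M[C]_n) :
  A \is hermsymmx -> A^t* = A.
Proof. by move=> /is_hermitianmxP{2}->; rewrite expr0 scale1r. Qed.

Lemma gram_herm (C : numClosedFieldType) (m n : nat) (Z : 'M[C]_(m, n)) :
  Z^t* *m Z \is hermsymmx.
Proof.
by apply/is_hermitianmxP; rewrite expr0 scale1r trmxC_mul trmxCK.
Qed.

(** Diagonalise the Gram matrix of [M] by the unitary [P], with eigenvalues [h]. The singular values
    are the square roots of [h], [V] is the adjoint of [P], and [U] is [M *m V] with its columns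
    normalised. Invertibility of [M] makes every eigenvalue nonzero, so that this normalisation is
    possible. *)
Lemma unitmx_svd (C : numClosedFieldType) (n : nat) (M : 'M[C]_n) :
  M \in unitmx ->
  exists U V : 'M[C]_n, exists s : 'rV[C]_n,
    [/\ U \is unitarymx, V \is unitarymx, forall i, 0 <= s 0 i
      & U^t* *m M *m V = diag_mx s].
Proof.
move=> Mu; set H := M^t* *m M.
have Hherm : H \is hermsymmx by apply: gram_herm.
have /esym defH := orthomx_spectralP (hermitian_normalmx Hherm).
set P := spectralmx H in defH *; set h := spectral_diag H in defH *.
have Pu : P \is unitarymx by apply: spectral_unitarymx.
have Vu : P^t* \is unitarymx by rewrite trmxC_unitary.
have PPt : P *m P^t* = 1%:M by apply/unitarymxP.
have hE : diag_mx h = (M *m P^t*)^t* *m (M *m P^t*).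
  rewrite trmxC_mul trmxCK -mulmxA (mulmxA (M^t*)) -/H -defH invmx_unitary//.
  by rewrite -!mulmxA PPt mulmx1 mulmxA PPt mul1mx.
have h_ge0 i : 0 <= h 0 i.
  have := gram_diag_ge0 (M *m P^t*) i.
  by rewrite -hE mxE eqxx mulr1n.
have h_neq0 i : h 0 i != 0.
  have : diag_mx h \in unitmx.
    rewrite hE unitmx_mul map_unitmx unitmx_tr andbb unitmx_mul Mu.
    exact: unitarymx_unit.
  rewrite unitmxE det_diag unitfE => /prodf_neq0/(_ i)->//.
pose D := \row_i (sqrtC (h 0 i))^-1.
have Dt : (diag_mx D)^t* = diag_mx D.
  apply/matrixP => i j; rewrite !mxE eq_sym.
  case: eqP => [->|_]; rewrite ?mulr0n ?rmorph0// !mulr1n.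
  by rewrite geC0_conj// invr_ge0 sqrtC_ge0.
exists (M *m P^t* *m diag_mx D), (P^t*), (\row_i sqrtC (h 0 i)); split=> //.
(* Passing to the adjoint turns the goal into U^* U = 1, where the Gram matrix [hE] appears between
   two copies of [diag_mx D]. *)
- rewrite -trmxC_unitary; apply/unitarymxP.
  rewrite trmxCK trmxC_mul Dt -mulmxA (mulmxA ((M *m P^t*)^t*)) -hE !mulmx_diag.
  apply/matrixP => i j; rewrite !mxE; case: eqP => // ->.
  have x0 : sqrtC (h 0 j) != 0 by rewrite sqrtC_eq0.
  by rewrite !mulr1n -{2}(sqrtCK (h 0 j)); field.
- by move=> i; rewrite mxE sqrtC_ge0.
- rewrite trmxC_mul Dt -!mulmxA -hE mulmx_diag.
  congr diag_mx; apply/rowP => i; rewrite !mxE.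
  have x0 : sqrtC (h 0 i) != 0 by rewrite sqrtC_eq0.
  by rewrite -{2}(sqrtCK (h 0 i)); field.
Qed.

(** * Averages of unitary multiplications *)

Section UnitarilyInvariantNorm.
Context (R : realType) (d : nat) (N : 'M[R[i]]_d -> R).
Context (hN : is_norm N) (hU : unitarily_invariant N).
Implicit Types (X Y A B T U : 'M[R[i]]_d).

Let NUl U X : U \is unitarymx -> N (U *m X) = N X.
Proof. by move=> Uu; case: (hU X Uu). Qed.

Let NUr U X : U \is unitarymx -> N (X *m U) = N X.
Proof. by move=> Uu; case: (hU X Uu). Qed.

Lemma norm_scaler (r : R) X : 0 <= r -> N (r%:C *: X) = r * N X.
Proof.
move=> r0; have := norm_scale hN r%:C X.
by rewrite ger0_norm ?ler0c// -rmorphM => /complexI.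
Qed.

Lemma norm_opp X : N (- X) = N X.
Proof.
have := norm_scale hN (-1) X.
by rewrite scaleN1r normrN1 mul1r => /complexI.
Qed.

Lemma norm_midpoint X Y : N (2^-1 *: (X + Y)) <= 2^-1 * (N X + N Y).
Proof.
have -> : 2^-1 = (2^-1 : R)%:C by rewrite fmorphV rmorph_nat.
rewrite norm_scaler ?invr_ge0 ?ler0n// ler_pM2l ?invr_gt0 ?ltr0n//.
exact: norm_triangle.
Qed.

Lemma norm_midpoint_le X Y (r : R) :
  N X <= r -> N Y <= r -> N (2^-1 *: (X + Y)) <= r.
Proof. by move=> Xr Yr; apply: le_trans (norm_midpoint X Y) _; lra. Qed.

Lemma diag_mx_unitary (u : 'rV[R[i]]_d) :
  (forall k, u 0 k * (u 0 k)^* = 1) -> diag_mx u \is unitarymx.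
Proof.
move=> hu; apply/unitarymxP; apply/matrixP => j k.
rewrite mul_diag_mx !mxE eq_sym; case: eqP => [->|_].
  by rewrite !mulr1n hu.
by rewrite !mulr0n rmorph0 mulr0.
Qed.

(* A number c in [0, 1] is the midpoint of the unimodular numbers
   c +/- i sqrt (1 - c^2), so diag c is the midpoint of two unitaries. *)
Lemma norm_diag_contraction (c : 'rV[R[i]]_d) X :
  (forall k, 0 <= c 0 k <= 1) -> N (diag_mx c *m X) <= N X.
Proof.
move=> hc; pose w k := sqrtC (1 - c 0 k ^+ 2).
have wr k : (w k)^* = w k.
  case/andP: (hc k) => c0 c1.
  by rewrite geC0_conj// sqrtC_ge0 subr_ge0 expr_le1.
have cr k : (c 0 k)^* = c 0 k by case/andP: (hc k) => c0 _; rewrite geC0_conj.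
have wK k : w k ^+ 2 = 1 - c 0 k ^+ 2 by rewrite sqrtCK.
pose u := \row_k (c 0 k + 'i * w k); pose v := \row_k (c 0 k - 'i * w k).
have uu : diag_mx u \is unitarymx.
  apply: diag_mx_unitary => k; rewrite !mxE rmorphD rmorphM /= conjCi wr cr.
  transitivity (c 0 k ^+ 2 - 'i ^+ 2 * w k ^+ 2); first by ring.
  by rewrite sqrCi wK; ring.
have vu : diag_mx v \is unitarymx.
  apply: diag_mx_unitary => k; rewrite !mxE rmorphB rmorphM /= conjCi wr cr.
  transitivity (c 0 k ^+ 2 - 'i ^+ 2 * w k ^+ 2); first by ring.
  by rewrite sqrCi wK; ring.
have -> : diag_mx c *m X = 2^-1 *: (diag_mx u *m X + diag_mx v *m X).
  by apply/matrixP => j k; rewrite !mul_diag_mx !mxE; field.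
by apply: norm_midpoint_le; [rewrite (NUl _ uu)|rewrite (NUl _ vu)].
Qed.

(* Conjugating by the reflection in the k-th coordinate changes the sign of
   the entries with exactly one index equal to k, so averaging kills them. *)
Lemma norm_pinching T : N (diag_mx (\row_k T k k)) <= N T.
Proof.
(* [tr k] is [T] without the off-diagonal entries that have an index below [k]: it runs from [T] at
   0 to the diagonal part at [d], one reflection per step. *)
pose tr (k : nat) : 'M[R[i]]_d :=
  \matrix_(a, b) (if (a == b) || ((k <= a) && (k <= b))%N then T a b else 0).
have tr_le k : (k <= d)%N -> N (tr k) <= N T.
  elim: k => [_|k IH ltkd].
    rewrite le_eqVlt; apply/orP; left; apply/eqP; congr N.
    by apply/matrixP => a b; rewrite mxE !leq0n orbT.
  apply: le_trans (IH (ltnW ltkd)).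
  pose p := \row_(a < d) (-1 : R[i]) ^+ (a == k :> nat).
  have pu : diag_mx p \is unitarymx.
    apply: diag_mx_unitary => a; rewrite mxE rmorphXn rmorphN1.
    by rewrite -exprMn mulN1r opprK expr1n.
  have -> : tr k.+1 = 2^-1 *: (tr k + diag_mx p *m tr k *m diag_mx p).
    apply/matrixP => a b; rewrite mul_mx_diag mul_diag_mx !mxE.
    rewrite ![(k < _)%N]ltn_neqAle ![k == _]eq_sym -[a == b]val_eqE /=.
    move: (T a b) => x; case: (eqVneq (a : nat) b) => [->|ab] /=.
      by rewrite mulrAC -signr_addb addbb mul1r; field.
    case: (eqVneq (a : nat) k) ab => [->|_]; case: (eqVneq (b : nat) k) => [->|_];
      rewrite ?eqxx ?leqnn ?andbF ?andbT //= => _;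
      (try by field); by case: ifP => _; field.
  by apply: norm_midpoint_le; rewrite // (NUr _ pu) (NUl _ pu).
have -> : diag_mx (\row_k T k k) = tr d.
  apply/matrixP => a b; rewrite !mxE; case: eqP => [->|_] //=.
  by rewrite leqNgt ltn_ord.
exact: tr_le.
Qed.

(** Pinching replaces [T] by its diagonal, and [diag_mx s] is that diagonal times a contraction. *)
Lemma norm_diag_le (s : 'rV[R[i]]_d) T :
  (forall k, 0 <= s 0 k <= T k k) -> N (diag_mx s) <= N T.
Proof.
move=> hs; apply: le_trans (norm_pinching T).
(* Where [T k k] is 0, the quotient is 0 by convention; there [s 0 k] is squeezed to 0, so the
   factorisation persists. *)
pose c := \row_k (s 0 k / T k k).
have -> : diag_mx s = diag_mx c *m diag_mx (\row_k T k k).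
  rewrite mulmx_diag; congr diag_mx; apply/rowP => k; rewrite !mxE.
  case/andP: (hs k) => s0; have [->|T0 _] := eqVneq (T k k) 0.
    by move=> s0'; rewrite mulr0; apply/eqP; rewrite eq_le s0'.
  by rewrite divfK.
apply: norm_diag_contraction => k; rewrite mxE.
case/andP: (hs k) => s0 sT; have T0 := le_trans s0 sT.
rewrite divr_ge0//=; have [->|Tn0] := eqVneq (T k k) 0.
  by rewrite invr0 mulr0 ler01.
by rewrite ler_pdivrMr ?mul1r// lt_def Tn0.
Qed.

(** * The arithmetic-geometric mean inequality *)

Lemma norm_amgm_unit X Y : X^t* *m Y \in unitmx ->
  N (X^t* *m Y) <= 2^-1 * (N (X^t* *m X) + N (Y^t* *m Y)).
Proof.
move=> /unitmx_svd[U [V [s [Uu Vu s0 defs]]]].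
have Utu : U^t* \is unitarymx by rewrite trmxC_unitary.
have Vtu : V^t* \is unitarymx by rewrite trmxC_unitary.
have sE : (X *m U)^t* *m (Y *m V) = diag_mx s by rewrite trmxC_mul -defs !mulmxA.
(* A real diagonal matrix is its own adjoint, so both cross terms of the Gram matrix of
   [X *m U - Y *m V] equal [diag_mx s]. *)
have sE' : (Y *m V)^t* *m (X *m U) = diag_mx s.
  rewrite -[X *m U]trmxCK -trmxC_mul sE; apply/matrixP => a b; rewrite !mxE eq_sym.
  by case: eqP => [->|_]; rewrite ?mulr0n ?rmorph0// !mulr1n geC0_conj.
have <- : N (diag_mx s) = N (X^t* *m Y) by rewrite -defs (NUr _ Vu) (NUl _ Utu).
have <- : N ((X *m U)^t* *m (X *m U)) = N (X^t* *m X).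
  by rewrite trmxC_mul -mulmxA (NUl _ Utu) mulmxA (NUr _ Uu).
have <- : N ((Y *m V)^t* *m (Y *m V)) = N (Y^t* *m Y).
  by rewrite trmxC_mul -mulmxA (NUl _ Vtu) mulmxA (NUr _ Vu).
apply: le_trans (norm_midpoint _ _); apply: norm_diag_le => k.
rewrite s0 /=; have := gram_diag_ge0 (X *m U - Y *m V) k.
rewrite trmxC_sub mulmxBl !mulmxBr sE sE' !mxE eqxx mulr1n => h.
rewrite -subr_ge0; set x := \sum_j _ in h *; set y := \sum_j _ in h *.
have -> : 2^-1 * (x + y) - s 0 k = 2^-1 * (x - s 0 k - (s 0 k - y)) by field.
by rewrite mulr_ge0// invr_ge0 ler0n.
Qed.

(** If v (A + e) = 0 for a row v, then multiplying by the adjoint of v gives e |v|^2 + v A v^* = 0.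
    Both terms are nonnegative, hence v = 0. *)
Lemma possemidef_shift_unit A (e : R) : 0 < e -> possemidef A ->
  (A + (e%:C)%:M) \in unitmx.
Proof.
move=> e0 [_ Ap]; rewrite -row_free_unit -kermx_eq0; apply/rowV0P => v /sub_kermxP.
have := Ap (v^t*); rewrite trmxCK => A0.
have := gram_diag_ge0 (v^t*) 0; rewrite trmxCK => v0 vA.
have : e%:C * (v *m v^t*) 0 0 + (v *m A *m v^t*) 0 0 = 0.
  have -> : e%:C * (v *m v^t*) 0 0 + (v *m A *m v^t*) 0 0
      = (v *m (A + (e%:C)%:M) *m v^t*) 0 0.
    rewrite mulmxDr mul_mx_scalar mulmxDl -scalemxAl addrC.
    by rewrite [RHS]mxE; congr (_ + _); rewrite [RHS]mxE.
  by rewrite vA mul0mx mxE.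
move=> /eqP.
rewrite paddr_eq0 ?mulr_ge0 ?ler0c ?(ltW e0)// => /andP[].
rewrite mulf_eq0 => /orP[/eqP/complexI e00|]; first by rewrite e00 ltxx in e0.
by rewrite -dotmxE dnorm_eq0 => /eqP.
Qed.

(* The invertible case applied to A + t and B + t, letting t tend to 0. *)
Lemma norm_amgm_possemidef A B : possemidef A -> possemidef B ->
  N (A *m B) <= 2^-1 * (N (A *m A) + N (B *m B)).
Proof.
move=> Ap Bp; pose sh A (e : R) := A + (e%:C)%:M.
have shM X Y (e : R) :
    sh X e *m sh Y e = X *m Y + (e%:C *: (X + Y) + (e ^+ 2)%:C *: 1%:M).
  rewrite mulmxDl !mulmxDr mul_mx_scalar !mul_scalar_mx rmorphXn expr2.
  by rewrite scalemx1 scale_scalar_mx scalerDr -!addrA.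
have N0 X : 0 <= N X by apply: norm_ge0.
have shN X Y (e : R) : 0 < e ->
    N (e%:C *: (X + Y) + (e ^+ 2)%:C *: 1%:M)
    <= e * (N X + N Y) + e ^+ 2 * N 1%:M.
  move=> e0; apply: le_trans (norm_triangle hN _ _) _.
  rewrite !norm_scaler ?(ltW e0) ?sqr_ge0// lerD2r ler_pM2l//.
  exact: norm_triangle.
apply/ler_addgt0Pr => e e0.
(* Shifting back in [A *m B] and shifting the two squares each cost t (N A + N B) + t^2 N 1, the
   latter after halving. As t <= 1, the total is at most [t * K]; the final 1 keeps [K] positive. *)
pose K := 2 * (N A + N B + N 1%:M) + 1.
have K0 : 0 < K by have := N0 A; have := N0 B; have := N0 1%:M; rewrite /K; lra.
pose t := Num.min 1 (e / K).
have t0 : 0 < t by rewrite lt_min ltr01 divr_gt0.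
have t1 : t <= 1 by rewrite ge_min lexx.
have tK : t * K <= e by rewrite -ler_pdivlMr// ge_min lexx orbT.
have t2 : t ^+ 2 * N 1%:M <= t * N 1%:M.
  by rewrite ler_wpM2r// expr2 ler_piMr// ltW.
have shH X : possemidef X -> (sh X t)^t* = sh X t.
  move=> Xp; rewrite /sh linearD map_mxD /= (herm_trmxC Xp.1).
  by rewrite tr_scalar_mx map_scalar_mx /= geC0_conj// ler0c ltW.
have := @norm_amgm_unit (sh A t) (sh B t).
rewrite !shH// unitmx_mul !possemidef_shift_unit// => /(_ isT) amgm.
have shle X Y :
    N (sh X t *m sh Y t) <= N (X *m Y) + (t * (N X + N Y) + t ^+ 2 * N 1%:M).
  by rewrite shM (le_trans (norm_triangle hN _ _))// lerD2l shN.
have leAB :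
    N (A *m B) <= N (sh A t *m sh B t) + (t * (N A + N B) + t ^+ 2 * N 1%:M).
  rewrite -[A *m B](addrK (t%:C *: (A + B) + (t ^+ 2)%:C *: 1%:M)) -shM.
  by rewrite (le_trans (norm_triangle hN _ _))// lerD2l norm_opp shN.
apply: le_trans leAB _.
apply: le_trans (lerD (le_trans amgm _) (lexx _)) _.
  by apply: ler_wpM2l (lerD (shle A A) (shle B B)); rewrite invr_ge0 ler0n.
move: tK t2 t0; rewrite /K; clear.
move: (N (A *m A)) (N (B *m B)) (N A) (N B) (N 1%:M) (t ^+ 2) => aa bb a b c t2.
lra.
Qed.

End UnitarilyInvariantNorm.

(** * Summation over pairs *)

Theorem proposition3p2 (R : realType) (n d : nat) (hn : (2 <= n)%N)
    (hd : (1 <= d)%N) (N : 'M[R[i]]_d -> R) (hN : is_norm N)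
    (hU : unitarily_invariant N) (A : 'I_n -> 'M[R[i]]_d)
    (hA : forall j, possemidef (A j)) :
  (n%:R ^+ 2)^-1 * (\sum_(j < n) \sum_(k < n) N (A j *m A k)) >=
  (n%:R * (n%:R - 1))^-1 *
    (\sum_(j < n) \sum_(k < n | j != k) N (A j *m A k)).
Proof.
set S := \sum_(j < n) \sum_(k < n | j != k) _.
pose D := \sum_(j < n) N (A j *m A j).
have n1 : 0 < n%:R - 1 :> R by rewrite subr_gt0 ltr1n.
have n0 : 0 < n%:R :> R by rewrite ltr0n; case: n hn {A hA S D n1}.
have -> : \sum_(j < n) \sum_(k < n) N (A j *m A k) = D + S.
  rewrite -big_split /=; apply: eq_bigr => j _; rewrite (bigD1 j)//=.
  by congr (_ + _); apply: eq_bigl => k; rewrite eq_sym.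
have card_neq (j : 'I_n) : \sum_(k < n | j != k) 1 = n%:R - 1 :> R.
  have : \sum_(k < n) 1 = n%:R :> R by rewrite sumr_const card_ord.
  rewrite (bigD1 j)//= => <-; rewrite [1 + _]addrC addrK.
  by apply: eq_bigl => k; rewrite eq_sym.
have rowE : \sum_(j < n) \sum_(k < n | j != k) N (A j *m A j) = (n%:R - 1) * D.
  rewrite mulr_sumr; apply: eq_bigr => j _.
  by rewrite -(card_neq j) mulr_suml; apply: eq_bigr => k _; rewrite mul1r.
have colE : \sum_(j < n) \sum_(k < n | j != k) N (A k *m A k) = (n%:R - 1) * D.
  rewrite -rowE (exchange_big_dep xpredT)//=.
  by apply: eq_bigr => k _; apply: eq_bigl => j; rewrite eq_sym.
(* Each square norm occurs n - 1 times as a row term and n - 1 times as a column term, and the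
   factor 1/2 merges the two. *)
have SD : S <= (n%:R - 1) * D.
  have -> : (n%:R - 1) * D = \sum_(j < n) \sum_(k < n | j != k)
      2^-1 * (N (A j *m A j) + N (A k *m A k)).
    under eq_bigr do rewrite -mulr_sumr big_split /=.
    by rewrite -mulr_sumr big_split /= rowE colE; field.
  by apply: ler_sum => j _; apply: ler_sum => k _; apply: norm_amgm_possemidef.
rewrite mulrC ler_pdivrMr ?mulr_gt0// [_^-1 * _]mulrC mulrAC ler_pdivlMr ?exprn_gt0//.
(* With denominators cleared, the goal is [SD] multiplied by n: the difference of the two sides is n
   ((n - 1) D - S). *)
nra.
Qed.
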